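(* Let $H$ be a separable infinite-dimensional Hilbert space, and let $T_1\ge T_2\ge\cdots$ be a sequence of positive linear contractions on $H$. Let $S_n:=T_nT_{n-1}\cdots T_1$, let $T:=\lim_{n\to\infty}T_n$ (limit in the strong operator topology), and let $P:=1_{\{1\}}(T)$. Then $\lim_{n\to\infty}S_n=P$ in the weak operator topology.
   Context: A positive contraction on $H$ is a bounded self-adjoint operator $T$ with $0\le T\le 1$; $T\ge T'$ means that $T-T'$ is positive. A non-increasing sequence of positive operators always converges in the strong operator topology, so $T$ exists. For a Borel set $A\subset\mathbb{R}$, $1_A(T)$ denotes the spectral projection of $T$ corresponding to $A$; thus $1_{\{1\}}(T)$ is the orthogonal projection onto $\ker(T-1)$. *)

(* Defs.v *)
From HB Require Import structures.
From mathcomp Require Import all_boot all_order all_algebra.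
From mathcomp Require Import sesquilinear.
From mathcomp Require Import complex.
From mathcomp Require Import all_classical all_reals all_analysis.

Set Implicit Arguments.
Unset Strict Implicit.
Unset Printing Implicit Defensive.

Import Order.TTheory GRing.Theory Num.Theory Num.Def.
Import numFieldNormedType.Exports.

Local Open Scope classical_set_scope.
Local Open Scope ring_scope.
Local Open Scope complex_scope.

Definition separable_space (X : topologicalType) : Prop :=
  exists D : set X, countable D /\ dense D.

Definition infinite_dimensional (K : fieldType) (V : lmodType K) : Prop :=
  ~ exists (n : nat) (e : 'I_n -> V),
      forall x : V, exists c : 'I_n -> K, x = \sum_(i < n) c i *: e i.

Section Operators.
Variables (R : realType) (H : completeNormedModType R[i]).
Variable dot : {dot H for conjC}.

Definition bounded_operator (A : H -> H) : Prop :=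
  linear A /\ exists M : R, forall x : H, `|A x| <= M%:C * `|x|.

Definition self_adjoint (A : H -> H) : Prop :=
  forall x y : H, dot (A x) y = dot x (A y).

(* In the partial order of [R[i]], [0 <= z] means that [z] is real and
   nonnegative. *)
Definition positive_operator (A : H -> H) : Prop :=
  [/\ bounded_operator A, self_adjoint A & forall x : H, 0 <= dot (A x) x].

Definition le_operator (A B : H -> H) : Prop :=
  positive_operator (fun x => B x - A x).

Definition positive_contraction (A : H -> H) : Prop :=
  [/\ bounded_operator A, self_adjoint A,
      le_operator (fun=> 0) A & le_operator A id].

Definition orthogonal_projection (P : H -> H) : Prop :=
  [/\ bounded_operator P, self_adjoint P & forall x : H, P (P x) = P x].

Definition orthogonal_projection_onto (P : H -> H) (V : set H) : Prop :=
  orthogonal_projection P /\ range P = V.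

(* [E] is the projection-valued measure on the Borel sets of the real line with
   [A = \int l dE(l)], expressed through the scalar measures
   [mu_x := <E(.) x, x>]: [E B] is then the spectral projection [1_B(A)]. *)
Definition spectral_measure (A : H -> H) (E : set R -> H -> H) : Prop :=
  [/\ forall B : set R, measurable B -> orthogonal_projection (E B),
      forall x : H, E setT x = x,
      forall B C : set R, measurable B -> measurable C ->
        forall x : H, E (B `&` C) x = E B (E C x)
    & forall x : H, exists mu : {measure set R -> \bar R},
        [/\ forall B : set R, measurable B ->
              mu B = (complex.Re (dot (E B x) x))%:E,
            mu.-integrable setT (fun l : R => l%:E)
          & dot (A x) x = (\int[mu]_(l in setT) l)%R%:C] ].

Definition strong_limit (A_ : nat -> H -> H) : H -> H :=
  fun x => lim (A_ n x @[n --> \oo]).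

Definition cvg_weak_operator (A_ : nat -> H -> H) (A : H -> H) : Prop :=
  forall x y : H,
    (dot (A_ n x) y : R[i]^o) @[n --> \oo] --> (dot (A x) y : R[i]^o).

(* [partial_product T_ n] is [T_n T_(n-1) ... T_1]; the entry [T_ 0] is not
   used. *)
Fixpoint partial_product (T_ : nat -> H -> H) (n : nat) : H -> H :=
  if n is m.+1 then T_ n \o partial_product T_ m else id.

End Operators.

(* Main.v *)
(* For 0 <= D <= 1 one has D^2 <= D, hence |D x|^2 <= <D x, x>.  Applied to
   D = T_m - T_n this makes T_n x Cauchy; applied to 1 - T_n on ker (1 - T),
   where <x, x> = <T x, x> <= <T_n x, x>, it shows that T_n is the identity
   there.
   Applied to the powers of T it yields the mean ergodic limit P of T^n, the
   orthogonal projection onto ker (1 - T).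

   Since |u - T_n u|^2 <= |u|^2 - |T_n u|^2, consecutive differences of S_n x
   tend to 0, so <S_n x, z - T z> -> 0 for every z.  Telescoping,
   <S_n x, y - T^N y> -> 0, and N -> oo gives <S_n x, y - P y> -> 0, while
   <S_n x, P y> = <x, P y> for all n.

   For the spectral projection, the scalar spectral measures of T are carried by
   ]-oo, 1] because T <= 1, so T x = x forces the one of x to be concentrated
   at 1. *)
Require Import Defs.
From mathcomp Require Import all_boot all_order all_algebra.
From mathcomp Require Import sesquilinear.
From mathcomp Require Import complex.
From mathcomp Require Import ring.
From mathcomp Require Import all_classical all_reals all_analysis.
From mathcomp Require Import measurable_realfun.
Import Order.TTheory GRing.Theory Num.Theory Num.Def.
Import numFieldNormedType.Exports.
Local Open Scope classical_set_scope.
Local Open Scope ring_scope.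
Local Open Scope complex_scope.

Set Implicit Arguments.
Unset Strict Implicit.
Unset Printing Implicit Defensive.

(** * Measures on the real line that concentrate at a point *)

Lemma null_of_integral_le0 (R : realType) (mu : {measure set R -> \bar R})
    (f : R -> R) (N : set R) :
  measurable N -> mu N = 0%E -> (forall l, ~ N l -> 0 <= f l) ->
  mu.-integrable setT (EFin \o f) -> (\int[mu]_l (f l)%:E <= 0)%E ->
  mu [set l | f l != 0] = 0%E.
Proof.
move=> mN muN f_ge0 intf int_le0.
have mf := measurable_int _ intf.
(* Off the null set [N] the integrand equals its absolute value, so the integral of [|f|] is at most
   0. *)
have : (\int[mu]_(l in setT) `|(EFin \o f) l| = 0)%E.
  apply/eqP; rewrite eq_le integral_ge0// andbT.
  apply: le_trans int_le0; rewrite le_eqVlt; apply/orP; left; apply/eqP.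
  apply: ae_eq_integral => //; first exact: measurableT_comp.
  exists N; split=> // l /= /not_implyP[_]; apply: contra_notP => Nl.
  by rewrite ger0_norm// f_ge0.
move/(ae_eq_integral_abs mu measurableT mf).1 => [M [mM muM fM]].
apply: subset_measure0 (muM) => //.
  rewrite (_ : [set _ | _] = setT `&` [set l | (EFin \o f) l != 0%E]).
    exact: emeasurable_neq.
  by rewrite setTI; apply/seteqP; split=> l /=; rewrite eqe.
by move=> l /= fl; apply: fM => /= /(_ Logic.I) [] /eqP; apply/negP.
Qed.

Lemma Rintegral_dirac_mass (R : realType) (mu : {measure set R -> \bar R}) c :
  (mu setT < +oo)%E -> mu.-integrable setT (fun l : R => l%:E) ->
  mu (~` [set c]) = 0%E -> \int[mu]_(l in setT) l = c * fine (mu setT).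
Proof.
move=> fin_mu intl mu0.
rewrite /Rintegral (@ae_eq_integral _ _ _ mu setT (cst c%:E)) => //.
- by rewrite integral_cst// fineM// ge0_fin_numE.
- exists (~` [set c]); split => //; first exact: measurableC.
  by move=> l /= /not_implyP[_ lc] => e; apply: lc; rewrite e.
Qed.

Lemma integral_shift (R : realType) (mu : {measure set R -> \bar R}) (s : R) :
  (mu setT < +oo)%E -> mu.-integrable setT (fun l : R => l%:E) ->
  mu.-integrable setT (fun l : R => (s * (l - 1))%:E) /\
  (\int[mu]_l (s * (l - 1))%:E =
    (s * (\int[mu]_(l in setT) l - fine (mu setT)))%:E)%E.
Proof.
move=> fin_mu intl.
have int1 : mu.-integrable setT (fun=> 1%:E).
  apply/integrableP; split => //; under eq_integral do rewrite abse1.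
  by rewrite integral_cst// mul1e.
have intB := integrableB measurableT intl int1.
have E : (fun l : R => (s * (l - 1))%:E) =
    (fun l => s%:E * (l%:E - 1%:E))%E by [].
rewrite E; split; first exact: integrableZl.
have fin1 : mu setT \is a fin_num by rewrite ge0_fin_numE.
have finl := integrable_fin_num measurableT intl.
rewrite integralZl// integralB// integral_cst// mul1e EFinM EFinB.
by rewrite /Rintegral !fineK.
Qed.

(** The function [s * (l - 1)] is nonnegative almost everywhere with integral at most 0, hence null.
    The sign of [s] selects the side: [s = 1] serves measures on [[1, +oo[], [s = -1] those on
    []-oo, 1]]. *)
Lemma carried_by_unit (R : realType) (mu : {measure set R -> \bar R}) (s : R)
    (N : set R) :
  s != 0 -> (mu setT < +oo)%E -> mu.-integrable setT (fun l : R => l%:E) ->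
  measurable N -> mu N = 0%E -> (forall l, ~ N l -> 0 <= s * (l - 1)) ->
  s * (\int[mu]_(l in setT) l - fine (mu setT)) <= 0 ->
  mu (~` [set 1]) = 0%E.
Proof.
move=> s0 fin_mu intl mN muN ge0 le0.
have [ints E] := integral_shift s fin_mu intl.
rewrite -(null_of_integral_le0 mN muN ge0 ints) ?E ?lee_fin//.
congr (mu _); apply/seteqP; split=> l /=; rewrite mulf_eq0 (negbTE s0) subr_eq0.
  by move/eqP.
by move=> + e; rewrite e eqxx.
Qed.

(** * Nonnegative sequences in [R[i]] *)

Lemma nonincreasing_gap (R : realType) (a : nat -> R[i]) :
  (forall n, 0 <= a n) -> (forall n, a n.+1 <= a n) ->
  forall e : R[i], 0 < e -> exists N, forall m n,
    (N <= m)%N -> (m <= n)%N -> a m - a n < e.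
Proof.
move=> a_ge0 a_dec e e_gt0.
pose r n := complex.Re (a n).
have rE n : a n = (r n)%:C by rewrite /r RRe_real// ger0_real.
have eE : e = (complex.Re e)%:C by rewrite RRe_real// gtr0_real.
have r_dec : {homo r : m n / (m <= n)%N >-> n <= m}.
  apply/nonincreasing_seqP => n; have := a_dec n; by rewrite !rE lecR.
have r_ge0 n : 0 <= r n by have := a_ge0 n; rewrite rE lecR.
have r_cvg : cvgn r.
  apply: nonincreasing_is_cvgn => //; exists 0 => _ [n _ <-]; exact: r_ge0.
have re_gt0 : 0 < complex.Re e by move: e_gt0; rewrite {1}eE ltcR.
have /cvgrPdist_lt/(_ _ re_gt0)[N _ hN] := r_cvg.
exists N => m n Nm mn.
rewrite !rE eE -rmorphB ltcR.
have := hN m Nm; rewrite distrC => /(le_lt_trans (ler_norm _)).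
apply: le_lt_trans; rewrite lerB//.
exact: nonincreasing_cvgn_ge.
Qed.

(** A nonnegative sequence equals its sequence of norms, which tends to [|l|]; uniqueness of limits
    gives [l = |l|]. *)
Lemma closed_ge0_complex (R : realType) (u : nat -> R[i]) (l : R[i]) :
  (u n : R[i]^o) @[n --> \oo] --> (l : R[i]^o) ->
  (forall n, 0 <= u n) -> 0 <= l.
Proof.
move=> ul u_ge0.
have : (u n : R[i]^o) @[n --> \oo] --> (`|l| : R[i]^o).
  rewrite (_ : u = fun n => `|u n|); last first.
    by apply/funext => n; rewrite ger0_norm.
  exact: (@cvg_norm _ R[i]^o _ _ _ _ _ ul).
by move/(cvg_unique _ ul) => /= ->.
Qed.

Lemma cvg_addE (R : realType) (a b c : nat -> R[i]) (la lb : R[i]) :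
  (forall n, c n = a n + b n) ->
  (a n : R[i]^o) @[n --> \oo] --> (la : R[i]^o) ->
  (b n : R[i]^o) @[n --> \oo] --> (lb : R[i]^o) ->
  (c n : R[i]^o) @[n --> \oo] --> (la + lb : R[i]^o).
Proof. by move=> /funext -> ha hb; exact: cvgD ha hb. Qed.

(** * Cauchy-Schwarz and continuity of the inner product *)

Section InnerProduct.
Variables (R : realType) (H : completeNormedModType R[i]).
Variable dot : {dot H for conjC}.
Hypothesis dot_norm : forall x : H, dot x x = `|x| ^+ 2.

Lemma dotBl x y z : dot (x - y) z = dot x z - dot y z.
Proof. exact: linearBl. Qed.

Lemma dotBr x y z : dot z (x - y) = dot z x - dot z y.
Proof. exact: linearBr. Qed.

Lemma Cauchy_Schwarz x y : `|dot x y| <= `|x| * `|y|.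
Proof.
have [->|y0] := eqVneq y 0; first by rewrite linear0r !normr0 mulr0.
rewrite -ler_sqr ?nnegrE ?mulr_ge0// exprMn -!dot_norm.
have dy : dot y y != 0 by rewrite dnorm_eq0.
(* [c *: y] is the projection of [x] onto the line of [y]; Pythagoras then applies to
   [x = z + c *: y]. *)
pose c := dot x y / dot y y; pose z := x - c *: y.
have zy : dot z y = 0 by rewrite dotBl linearZl_LR /= divfK ?subrr.
have xE : x = z + c *: y by rewrite subrK.
have -> : dot x x = dot z z + `|c| ^+ 2 * dot y y.
  rewrite -(dnormZ dot) {1 2}xE; apply: hnormDd.
  by rewrite linearZr_LR/= zy mulr0.
have -> : dot x y = c * dot y y by rewrite /c divfK.
rewrite normrM exprMn (ger0_norm (dnorm_ge0 dot y)) mulrDl.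
rewrite (_ : `|c| ^+ 2 * dot y y * _ = `|c| ^+ 2 * dot y y ^+ 2); last by ring.
by rewrite lerDr mulr_ge0 ?(dnorm_ge0 dot).
Qed.

Lemma dot_cvgl (u : nat -> H) a y : u n @[n --> \oo] --> a ->
  (dot (u n) y : R[i]^o) @[n --> \oo] --> (dot a y : R[i]^o).
Proof.
move=> /cvgr_dist_lt ua; apply/cvgrPdist_lt => e e0.
(* The [+ 1] keeps the denominator positive when [y = 0]. *)
have d0 : 0 < e / (`|y| + 1) by rewrite divr_gt0 ?ltr_wpDl.
have := ua _ d0; apply: filterS => n.
rewrite ltr_pdivlMr ?ltr_wpDl// => h.
rewrite -dotBl; apply: le_lt_trans (Cauchy_Schwarz _ _) _.
by apply: le_lt_trans h; rewrite distrC ler_wpM2l// lerDl ler01.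
Qed.

Lemma dot_cvgr (u : nat -> H) a y : u n @[n --> \oo] --> a ->
  (dot y (u n) : R[i]^o) @[n --> \oo] --> (dot y a : R[i]^o).
Proof.
move=> /cvgr_dist_lt ua; apply/cvgrPdist_lt => e e0.
have d0 : 0 < e / (`|y| + 1) by rewrite divr_gt0 ?ltr_wpDl.
have := ua _ d0; apply: filterS => n.
rewrite ltr_pdivlMr ?ltr_wpDl// => h.
rewrite -dotBr; apply: le_lt_trans (Cauchy_Schwarz _ _) _.
by apply: le_lt_trans h; rewrite distrC mulrC ler_wpM2l// lerDl ler01.
Qed.

(* [0 <= A <= 1]; boundedness is a consequence. *)
Definition effect (A : H -> H) : Prop :=
  [/\ linear A, self_adjoint dot A, forall x, 0 <= dot (A x) x
    & forall x, dot (A x) x <= dot x x].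

Lemma linear_sub (A : H -> H) : linear A -> forall x y, A (x - y) = A x - A y.
Proof.
by move=> linA x y; rewrite addrC -scaleN1r linA scaleN1r addrC.
Qed.

Lemma positive_contraction_effect A : positive_contraction dot A -> effect A.
Proof.
move=> [[linA _] saA [_ _ posA] [_ _ conA]]; split=> // x.
- by have := posA x; rewrite subr0.
- by have := conA x; rewrite dotBl subr_ge0.
Qed.

(* [A - A^2 = A (1 - A) A + (1 - A) A (1 - A)] *)
Lemma effect_sqr A x : effect A -> dot (A x) (A x) <= dot (A x) x.
Proof.
move=> [linA saA posA conA]; have AB := linear_sub linA.
rewrite -subr_ge0.
have -> : dot (A x) x - dot (A x) (A x) =
    (dot (A x) (A x) - dot (A (A x)) (A x)) + dot (A (x - A x)) (x - A x).
  rewrite AB dotBl dotBr dotBr (saA (A x) x); ring.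
by rewrite addr_ge0// subr_ge0.
Qed.

Lemma effect_norm A x : effect A -> `|A x| <= `|x|.
Proof.
move=> eA; rewrite -ler_sqr ?nnegrE// -!dot_norm.
by apply: le_trans (effect_sqr x eA) _; case: eA.
Qed.

Lemma effect_bounded A : effect A -> bounded_operator A.
Proof.
move=> eA; split; first by case: eA.
by exists 1 => x; rewrite mul1r effect_norm.
Qed.

Lemma effect_compl A : effect A -> effect (fun x => x - A x).
Proof.
move=> [linA saA posA conA]; split=> [c x y|x y|x|x].
- by rewrite linA scalerBr opprD addrACA.
- by rewrite dotBl dotBr saA.
- by rewrite dotBl subr_ge0.
- by rewrite dotBl gerBl.
Qed.

Lemma effect_sub A B : effect A -> effect B ->
  (forall x, dot (B x) x <= dot (A x) x) -> effect (fun x => A x - B x).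
Proof.
move=> [linA saA posA conA] [linB saB posB conB] BA; split=> [c x y|x y|x|x].
- by rewrite linA linB scalerBr opprD addrACA.
- by rewrite dotBl dotBr saA saB.
- by rewrite dotBl subr_ge0.
- by rewrite dotBl (le_trans _ (conA x))// gerBl.
Qed.

Lemma effect_fixed A x : effect A -> dot x x <= dot (A x) x -> A x = x.
Proof.
move=> eA xA; have := effect_sqr x (effect_compl eA).
have h0 : dot (x - A x) x <= 0 by rewrite dotBl subr_le0.
move=> /le_trans/(_ h0) h.
apply/esym/eqP; rewrite -subr_eq0 -(dnorm_eq0 dot).
by rewrite eq_le h (dnorm_ge0 dot).
Qed.

(** * Strong limits of decreasing sequences of effects *)

Section DecreasingEffects.
Variable A_ : nat -> H -> H.
Hypothesis effA : forall n, effect (A_ n).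
Hypothesis decA : forall n x, dot (A_ n.+1 x) x <= dot (A_ n x) x.

Lemma effects_dec m n x : (m <= n)%N -> dot (A_ n x) x <= dot (A_ m x) x.
Proof.
elim: n => [|n IH]; first by rewrite leqn0 => /eqP->.
rewrite leq_eqVlt => /orP[/eqP->//|/IH]; exact: le_trans.
Qed.

Lemma effects_cvg x : A_ n x @[n --> \oo] --> strong_limit A_ x.
Proof.
suff: cvgn (A_ ^~ x) by [].
apply/cauchy_cvgP/cauchy_exP => e e0.
have a_ge0 n : 0 <= dot (A_ n x) x by case: (effA n).
(* The tolerance is [e ^+ 2] because the gap bounds the square of [|A_ N x - A_ n x|]. *)
have [N hN] := nonincreasing_gap a_ge0 (decA ^~ x) (exprn_gt0 2 e0).
exists (A_ N x), N => // n /= Nn.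
rewrite -ball_normE /= -ltr_sqr ?nnegrE ?(ltW e0)// -dot_norm.
apply: le_lt_trans (hN N n (leqnn N) Nn); rewrite -dotBl.
apply: (effect_sqr x (effect_sub (effA N) (effA n) _)) => y.
exact: effects_dec.
Qed.

Lemma strong_limit_le n x : dot (strong_limit A_ x) x <= dot (A_ n x) x.
Proof.
rewrite -subr_ge0 -dotBl.
(* Starting the index at [n] makes every term of the sequence nonnegative. *)
apply: (@closed_ge0_complex _ (fun m => dot (A_ n x - A_ (n + m)%N x) x)).
  apply: dot_cvgl; apply: cvgB; first exact: cvg_cst.
  have := @effects_cvg x; rewrite -(cvg_shiftn n) /=.
  by under eq_fun do rewrite addnC.
by move=> m; rewrite dotBl subr_ge0 effects_dec// leq_addr.
Qed.

Lemma strong_limit_effect : effect (strong_limit A_).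
Proof.
split=> [c x y|x y|x|x].
- apply: cvg_unique (@effects_cvg _) _ => //.
  have -> : A_ ^~ (c *: x + y) = (fun n => c *: A_ n x + A_ n y).
    by apply/funext => n; case: (effA n) => ->.
  by apply: cvgD; [apply: cvgZr|]; exact: effects_cvg.
- have h1 := dot_cvgl (y := y) (@effects_cvg x).
  have h2 := dot_cvgr (y := x) (@effects_cvg y).
  have E : (fun n => dot (A_ n x) y) = (fun n => dot x (A_ n y)).
    by apply/funext => n; case: (effA n) => _ ->.
  by move: h1; rewrite E; move/(cvg_unique _ h2) => /= ->.
- apply: closed_ge0_complex (dot_cvgl (@effects_cvg x)) _ => n.
  by case: (effA n).
- by apply: le_trans (strong_limit_le 0 x) _; case: (effA 0).
Qed.

End DecreasingEffects.

(** Each projection fixes the range of the other, so both fix [z = P x - Q x], and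
    [<z, z> = <x, P z - Q z> = 0]. *)
Lemma orthogonal_projection_unique (P Q : H -> H) :
  orthogonal_projection dot P -> orthogonal_projection dot Q ->
  range P = range Q -> forall x, P x = Q x.
Proof.
move=> [[linP _] saP idP] [[linQ _] saQ idQ] PQ x.
have QP z : Q (P z) = P z.
  have : range Q (P z) by rewrite -PQ; exists z.
  by move=> [w _ <-]; rewrite idQ.
have PQ' z : P (Q z) = Q z.
  have : range P (Q z) by rewrite PQ; exists z.
  by move=> [w _ <-]; rewrite idP.
apply/eqP; rewrite -subr_eq0 -(dnorm_eq0 dot); apply/eqP.
set z := P x - Q x.
rewrite {1}/z dotBl saP saQ /z !linear_sub// idP idQ QP PQ'; ring.
Qed.

Lemma effect_cvg (A : H -> H) (u : nat -> H) a : effect A ->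
  u n @[n --> \oo] --> a -> A (u n) @[n --> \oo] --> A a.
Proof.
move=> effA /cvgr_dist_lt ua; apply/cvgrPdist_lt => e /ua.
apply: filterS => n; apply: le_lt_trans.
have [linA _ _ _] := effA.
by rewrite -linear_sub//; exact: effect_norm.
Qed.

(** * The mean ergodic limit of the powers of an effect *)

Section MeanErgodic.
Variable T : H -> H.
Hypothesis effT : effect T.

(** Self-adjointness gives [<T^(n+2) x, x> = <T^n (T x), T x>], so induction in steps of two leaves
    [T <= 1] and [T^2 <= T]. *)
Lemma effect_iter_dec n x : dot (iter n.+1 T x) x <= dot (iter n T x) x.
Proof.
have [_ saT _ conT] := effT.
elim/ltn_ind: n x => -[|[|n]] IH x //=; first by rewrite saT effect_sqr.
have iterE m : dot (iter m.+2 T x) x = dot (iter m T (T x)) (T x).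
  by rewrite iterS saT iterSr.
rewrite -!iterS !iterE; exact: IH.
Qed.

Lemma effect_iter n : effect (iter n T).
Proof.
have [linT saT posT conT] := effT; split=> [c x y|x y|x|x].
- by elim: n => //= n ->; rewrite linT.
- by elim: n x y => // n IH x y; rewrite iterS iterSr saT IH.
- elim/ltn_ind: n x => -[|[|n]] IH x; [exact: (dnorm_ge0 dot)|exact: posT|].
  by rewrite iterS saT iterSr; exact: IH.
- elim: n => //= n; exact/le_trans/effect_iter_dec.
Qed.

Let P := strong_limit (fun n => iter n T).

Lemma mean_ergodic x : iter n T x @[n --> \oo] --> P x.
Proof. exact: effects_cvg effect_iter effect_iter_dec x. Qed.

Lemma mean_ergodic_effect : effect P.
Proof. exact: strong_limit_effect effect_iter effect_iter_dec. Qed.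

Lemma mean_ergodic_fixed x : T x = x -> P x = x.
Proof.
move=> Tx; have : iter n T x @[n --> \oo] --> x.
  rewrite (_ : (fun n => iter n T x) = fun=> x); first exact: cvg_cst.
  by apply/funext; elim=> //= n ->.
by move/(cvg_unique _ (@mean_ergodic x)) => ->.
Qed.

(** Both sides are limits of [iter n.+1 T x]: one by continuity of [T], the other by shifting the
    index. *)
Lemma mean_ergodic_invariant x : T (P x) = P x.
Proof.
have h := effect_cvg effT (@mean_ergodic x).
have : (iter n.+1 T x) @[n --> \oo] --> P x.
  by have := @mean_ergodic x; rewrite -cvg_shiftS.
by move/(cvg_unique _ h) => /= ->.
Qed.

Lemma mean_ergodic_projection :
  orthogonal_projection_onto dot P [set x | T x - x = 0].
Proof.
have effP := mean_ergodic_effect.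
split; first split.
- exact: effect_bounded.
- by case: effP.
- by move=> x; apply: mean_ergodic_fixed; exact: mean_ergodic_invariant.
- apply/seteqP; split=> [_ [x _ <-]|x /= /eqP].
    by rewrite /= mean_ergodic_invariant subrr.
  by rewrite subr_eq0 => /eqP/mean_ergodic_fixed Px; exists x.
Qed.

End MeanErgodic.

(** * Weak convergence of the products *)

Definition weakly_null (u : nat -> H) (z : H) : Prop :=
  (dot (u n) z : R[i]^o) @[n --> \oo] --> (0 : R[i]^o).

(** Boundedness of [u] makes the set of test vectors [z] with [<u n, z> -> 0] closed in norm; this
    permits [N -> oo] in [y - T^N y]. *)
Lemma weak_null_cvg (u : nat -> H) (M : R[i]) (w : nat -> H) z :
  (forall n, `|u n| <= M) -> w n @[n --> \oo] --> z ->
  (forall N, weakly_null u (w N)) ->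
  weakly_null u z.
Proof.
move=> uM /cvgr_dist_lt wz uw; apply/cvgrPdist_lt => e e0.
have M0 : 0 <= M by exact: le_trans (uM 0).
have d0 : 0 < e / 2 / (M + 1) by rewrite !divr_gt0 ?ltr_wpDl.
have [N _ /(_ N (leqnn N))] := wz _ d0.
rewrite ltr_pdivlMr ?ltr_wpDl// => wN.
have e2 : 0 < e / 2 by rewrite divr_gt0.
have /cvgrPdist_lt/(_ _ e2) := uw N.
apply: filterS => n; rewrite !sub0r !normrN => h.
rewrite -(subrK (w N) z) linearDr (splitr e) /=.
apply: le_lt_trans (ler_normD _ _) _.
rewrite ltrD//; apply: le_lt_trans (Cauchy_Schwarz _ _) _.
apply: le_lt_trans wN; rewrite distrC mulrC ler_wpM2l//.
by rewrite (le_trans (uM n))// lerDl.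
Qed.

Section Products.
Variable T_ : nat -> H -> H.
Hypothesis effT : forall n, effect (T_ n.+1).
Hypothesis decT : forall n x, dot (T_ n.+2 x) x <= dot (T_ n.+1 x) x.

Let T := strong_limit T_.
Let S_ := partial_product T_.
Let P := strong_limit (fun n => iter n T).

Lemma products_limit_cvg x : T_ n x @[n --> \oo] --> T x.
Proof.
suff : cvgn (T_ ^~ x) by [].
have := @effects_cvg (fun n => T_ n.+1) effT decT x.
by rewrite (cvg_shiftS (T_ ^~ x)); exact: cvgP.
Qed.

(** Nothing is assumed of [T_ 0], so the results on decreasing effects reach [T] through the shifted
    sequence. *)
Lemma products_limitE : T = strong_limit (fun n => T_ n.+1).
Proof.
apply/funext => x; have := @products_limit_cvg x; rewrite -cvg_shiftS.
by move=> /(cvg_unique _ (@effects_cvg (fun n => T_ n.+1) effT decT x)) ->.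
Qed.

Lemma products_limit_effect : effect T.
Proof. by rewrite products_limitE; exact: strong_limit_effect. Qed.

Lemma products_limit_fixed x n : T x = x -> T_ n.+1 x = x.
Proof.
move=> Tx; apply: effect_fixed => //; rewrite -{1}Tx products_limitE.
exact: (@strong_limit_le (fun n => T_ n.+1)).
Qed.

Lemma products_norm n x : `|S_ n x| <= `|x|.
Proof.
elim: n => //= n IH; exact: le_trans (effect_norm _ (effT n)) IH.
Qed.

Lemma products_step x : S_ n x - S_ n.+1 x @[n --> \oo] --> (0 : H).
Proof.
apply/cvgrPdist_lt => e e0.
have dec n : dot (S_ n.+1 x) (S_ n.+1 x) <= dot (S_ n x) (S_ n x).
  rewrite !dot_norm ler_sqr ?nnegrE//; exact: (effect_norm _ (effT n)).
have ge0 n : 0 <= dot (S_ n x) (S_ n x) := dnorm_ge0 dot _.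
have [N hN] := nonincreasing_gap ge0 dec (exprn_gt0 2 e0).
exists N => // n /= Nn.
rewrite sub0r normrN -ltr_sqr ?nnegrE ?(ltW e0)// -dot_norm.
apply: le_lt_trans (hN n n.+1 Nn (leqnSn n)) => /=.
set u := S_ n x; have [linA saA _ _] := effT n.
rewrite dotBl !dotBr (saA u u).
have := effect_sqr u (effT n); rewrite (saA u u) => h.
set v := T_ n.+1 u.
(* By [effect_sqr], [<u, v> - <v, v>] is nonnegative, which leaves [|u - v|^2 <= |u|^2 - |v|^2], a
   gap of the nonincreasing squared norms. *)
have -> : dot u u - dot u v - (dot u v - dot v v) =
    dot u u - dot v v - (dot u v - dot v v) *+ 2 by ring.
by rewrite gerBl mulrn_wge0// subr_ge0.
Qed.

(** Since [<S_(n+1) x, z> = <S_n x, T_(n+1) z>], the pairing splits as [<S_n x - S_(n+1) x, z> +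
    <S_n x, T_(n+1) z - T z>]; the second term vanishes in the limit because [|S_n x| <= |x|]. *)
Lemma products_weak_null x z : weakly_null (fun n => S_ n x) (z - T z).
Proof.
have h1 := dot_cvgl (y := z) (@products_step x).
have h2 : (dot (S_ n x) (T_ n.+1 z - T z) : R[i]^o) @[n --> \oo]
    --> (0 : R[i]^o).
  apply/cvgrPdist_lt => e e0.
  have d0 : 0 < e / (`|x| + 1) by rewrite divr_gt0 ?ltr_wpDl.
  have := @products_limit_cvg z; rewrite -cvg_shiftS => /cvgr_dist_lt/(_ _ d0).
  apply: filterS => n; rewrite ltr_pdivlMr ?ltr_wpDl// => h.
  rewrite sub0r normrN; apply: le_lt_trans (Cauchy_Schwarz _ _) _.
  apply: le_lt_trans h; rewrite distrC mulrC ler_wpM2l//.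
  by rewrite (le_trans (products_norm n x))// lerDl.
rewrite linear0l in h1.
rewrite /weakly_null -[X in _ --> X](addr0 (0 : R[i])).
apply: (cvg_addE _ h1 h2) => n; rewrite dotBl !dotBr /=.
by have [linA saA _ _] := effT n; rewrite saA addrA subrK.
Qed.

Lemma products_fixed n x y : T y = y -> dot (S_ n x) y = dot x y.
Proof.
move=> Ty; elim: n => //= n IH; have [_ saA _ _] := effT n.
by rewrite saA products_limit_fixed.
Qed.

Lemma products_cvg_weak : cvg_weak_operator dot S_ P.
Proof.
move=> x y; have effP := mean_ergodic_effect products_limit_effect.
have TP : T (P y) = P y := mean_ergodic_invariant products_limit_effect y.
have : weakly_null (fun n => S_ n x) (y - P y).
  apply: (@weak_null_cvg _ `|x| (fun N => y - iter N T y)).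
  - by move=> n; exact: products_norm.
  - exact: cvgB (cvg_cst y) (@mean_ergodic T products_limit_effect y).
  (* The increment from [N] to [N + 1] is [w - T w] with [w = T^N y]. *)
  - elim=> [|N IH] /=.
      have d0 n : dot (S_ n x) (y - y) = 0 by rewrite subrr linear0r.
      by rewrite /weakly_null (funext d0); exact: cvg_cst.
    rewrite /weakly_null -[X in _ --> X](addr0 (0 : R[i])).
    apply: (cvg_addE _ IH (@products_weak_null x (iter N T y))) => n.
    by rewrite !dotBr addrA subrK.
move=> h; have [_ saP _ _] := effP.
rewrite saP -[X in _ --> X]add0r.
apply: (cvg_addE _ h (cvg_cst (dot x (P y) : R[i]^o))) => n.
by rewrite dotBr -(products_fixed n x TP) subrK.
Qed.

End Products.

(** * The spectral projection at 1 *)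

Section Spectral.
Variables (A : H -> H) (E : set R -> H -> H).
Hypotheses (effA : effect A) (specE : spectral_measure dot A E).

(** [<E(B) x, x> = |E(B) x|^2] is already real, so a vanishing real part kills the vector. *)
Lemma spectral_eq0 B x (mu : {measure set R -> \bar R}) :
  measurable B -> mu B = (complex.Re (dot (E B x) x))%:E ->
  mu B = 0%E -> E B x = 0.
Proof.
have [projE _ _ _] := specE; move=> mB -> [Re0].
have [_ saE idE] := projE B mB.
apply/eqP; rewrite -(dnorm_eq0 dot) -saE idE; apply/eqP.
have : 0 <= dot (E B x) x by rewrite -idE saE; exact: (dnorm_ge0 dot).
by move=> /ger0_real/RRe_real <-; rewrite Re0.
Qed.

(** Multiplicativity reduces this to [E set0 x = 0], which holds because [mu set0 = 0]. *)
Lemma spectral_disjoint B C x : measurable B -> measurable C ->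
  B `&` C = set0 -> E B (E C x) = 0.
Proof.
have [_ _ EI muE] := specE; move=> mB mC BC.
have [mu [muEx _ _]] := muE x.
rewrite -EI// BC; apply: (spectral_eq0 (mu := mu)) => //; exact: muEx.
Qed.

(** The measure of [y = E(]1, +oo[) x] is carried by []1, +oo[], yet its first moment [<A y, y>] is
    at most its mass [<y, y>]. It therefore sits at 1, outside that interval, and vanishes. *)
Lemma spectral_support x : E `]1, +oo[ x = 0.
Proof.
have [projE ET EI muE] := specE.
have mB : measurable (`]1, +oo[ : set R) by exact: measurable_itv.
set B : set R := `]1, +oo[%classic in mB *; set y := E B x.
have [mu [muEy intl Ay]] := muE y.
have Ey : E B y = y by rewrite /y -EI// setIid.
have [linA saA posA conA] := effA.
have mC := measurableC mB.
have muN : mu (~` B) = 0%E.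
  by rewrite muEy// spectral_disjoint ?setICl// linear0l.
have mu1 : mu (~` [set 1]) = 0%E.
  apply: (carried_by_unit (oner_neq0 R) _ intl mC muN).
  - by rewrite muEy// ltry.
  - by move=> l /contrapT; rewrite /B /= in_itv/= andbT mul1r subr_ge0 => /ltW.
  - rewrite mul1r subr_le0 muEy// ET /=.
    by have := conA y; rewrite Ay lecE => /andP[].
rewrite -Ey; apply: spectral_eq0 (muEy _ mB) _ => //.
apply: subset_measure0 mu1 => //; first exact: measurableC (measurable_set1 _).
by move=> l; rewrite /B /= in_itv/= andbT => + e; rewrite e ltxx.
Qed.

(** The measure of [y = E({1}) x] sits at 1, so [<A y, y> = <y, y>] and [effect_fixed] applies. *)
Lemma spectral_unit_fixed x : A (E [set 1] x) = E [set 1] x.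
Proof.
have [projE ET EI muE] := specE.
have m1 : measurable ([set 1] : set R) by exact: measurable_set1.
set y := E [set 1] x; have [mu [muEy intl Ay]] := muE y.
have mu1 : mu (~` [set 1]) = 0%E.
  by rewrite muEy ?spectral_disjoint ?setICl ?linear0l//; exact: measurableC m1.
apply: effect_fixed => //.
rewrite Ay (Rintegral_dirac_mass _ intl mu1) ?muEy ?ltry// mul1r ET /=.
by rewrite RRe_real// ger0_real// (dnorm_ge0 dot).
Qed.

Lemma spectral_fixed_unit x : A x = x -> E [set 1] x = x.
Proof.
move=> Ax; have [projE ET EI muE] := specE.
have m1 : measurable ([set 1] : set R) by exact: measurable_set1.
have mB : measurable (`]1, +oo[ : set R) by exact: measurable_itv.
have [mu [muEx intl xx]] := muE x.
have xxR : \int[mu]_(l in setT) l = complex.Re (dot x x) by rewrite -{1}Ax xx.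
have mu1 : mu (~` [set 1]) = 0%E.
  (* [1 - l] is nonnegative off the null set []1, +oo[], and its integral is
     [<x, x> - <A x, x> = 0]. *)
  apply: (carried_by_unit (s := -1) _ _ intl mB).
  - by rewrite oppr_eq0 oner_eq0.
  - by rewrite muEx// ltry.
  - by rewrite muEx// spectral_support linear0l.
  - move=> l /negP; rewrite /= in_itv/= andbT -leNgt.
    by rewrite mulN1r oppr_ge0 subr_le0.
  - by rewrite muEx// ET xxR subrr mulr0.
have [_ saQ idQ] := projE _ m1.
(* All the mass is at 1, that is [<E({1}) x, x> = <x, x>]; the difference of the two is
   [|x - E({1}) x|^2]. *)
have : mu setT = (mu [set 1%R] + mu (~` [set 1%R]))%E.
  rewrite -[in LHS](setUv [set (1 : R)]).
  exact: measureU m1 (measurableC m1) (setICr _).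
rewrite mu1 adde0 !muEx// ET => -[Re_eq].
apply/eqP; rewrite eq_sym -subr_eq0 -(dnorm_eq0 dot).
have -> : dot (x - E [set 1] x) (x - E [set 1] x) =
    dot x x - dot (E [set 1] x) x.
  by rewrite !(dotBl, dotBr) (saQ x (E _ x)) idQ -(saQ x x); ring.
have Qge0 : 0 <= dot (E [set 1] x) x by rewrite -idQ saQ (dnorm_ge0 dot).
rewrite -(RRe_real (ger0_real Qge0)) -Re_eq RRe_real ?subrr//.
exact: ger0_real (dnorm_ge0 dot x).
Qed.

End Spectral.

End InnerProduct.

Unset Implicit Arguments.
Set Strict Implicit.

Theorem proposition1p4 (R : realType) (H : completeNormedModType R[i])
    (dot : {dot H for conjC})
    (dot_norm : forall x : H, dot x x = `|x| ^+ 2)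
    (H_separable : separable_space H)
    (H_infinite : infinite_dimensional H)
    (T_ : nat -> H -> H)
    (T_contraction : forall n, (0 < n)%N -> positive_contraction dot (T_ n))
    (T_decreasing : forall n, (0 < n)%N -> le_operator dot (T_ n.+1) (T_ n)) :
  let S_ := partial_product T_ in
  let T := strong_limit T_ in
  (forall x : H, T_ n x @[n --> \oo] --> T x) /\
  exists P : H -> H,
    [/\ orthogonal_projection_onto dot P [set x | T x - x = 0],
        forall E, spectral_measure dot T E -> forall x, E [set 1] x = P x
      & cvg_weak_operator dot S_ P].
Proof.
move=> S_ T.
have effT n : effect dot (T_ n.+1).
  exact: positive_contraction_effect (T_contraction n.+1 (ltn0Sn n)).
have decT n x : dot (T_ n.+2 x) x <= dot (T_ n.+1 x) x.
  have [_ _ /(_ x)] := T_decreasing n.+1 (ltn0Sn n).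
  by rewrite dotBl subr_ge0.
have eT := products_limit_effect dot_norm effT decT.
split; first exact: products_limit_cvg.
have projP := mean_ergodic_projection dot_norm eT.
exists (strong_limit (fun n => iter n T)); split=> //.
  move=> E specE; have [projE _ _ _] := specE.
  (* It remains to see that the range of [E [set 1]] is the kernel of [T - 1], which is the range of
     the ergodic limit. *)
  apply: (orthogonal_projection_unique (projE _ (measurable_set1 _)) projP.1).
  rewrite projP.2; apply/seteqP; split=> [_ [x _ <-]|x /= /eqP].
    by rewrite /= (spectral_unit_fixed eT specE) subrr.
  rewrite subr_eq0 => /eqP Tx; exists x => //.
  exact: (spectral_fixed_unit eT specE Tx).
exact: (products_cvg_weak dot_norm effT decT).
Qed.
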